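(* Each of the following graphs $G$ satisfies $\sigma_T(G)=g(G)-1$, where $g(G)$ is the girth of $G$, with the following values: (1) $\sigma_T(K_n)=2$ for the complete graphs $K_n$ ($n\geq 3$). (2) $\sigma_T(C_n)=n-1$ for the cycles $C_n$ ($n\geq 3$). (3) $\sigma_T(W_n)=2$ for the wheels $W_n=C_{n-1}\vee K_1$ ($n\geq 4$). (4) $\sigma_T(D_n)=2$ for the diamonds $D_n=K_2\vee \overline{K}_{n-2}$ ($n\geq 4$). (5) $\sigma_T(K_{m,n})=3$ for the complete bipartite graphs $K_{m,n}$ ($m,n\geq 2$). (6) $\sigma_T(P_3\times P_n)=3$ for the planar grids $P_3\times P_n$ ($n\geq 2$). (7) $\sigma_T(G)=4$ for the Petersen graph $G$.
   Context: All graphs are finite and simple. For a connected graph $G$ (with at least one edge) and a spanning tree $T$ of $G$, let $d_T(u,v)$ be the distance between $u$ and $v$ in $T$. The stretch of $T$ is $\sigma_T(G,T):=\max_{uv\in E(G)} d_T(u,v)$, and the tree-stretch of $G$ is $\sigma_T(G):=\min\{\sigma_T(G,T): T \text{ is a spanning tree of } G\}$ (the subscript $T$ in $\sigma_T(G)$ is part of the notation and does not refer to a particular tree). The girth $g(G)$ is the length of a shortest cycle in $G$. $P_n$, $C_n$, $K_n$ denote the path, cycle and complete graph on $n$ vertices, and $\overline{K}_n$ is the edgeless graph on $n$ vertices. The join $G\vee H$ is the disjoint union of $G$ and $H$ together with all edges from every vertex of $G$ to every vertex of $H$. The cartesian product $G\times H$ has vertex set $V(G)\times V(H)$, with $(u,v)$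 and $(u',v')$ adjacent if and only if either $u=u'$ and $vv'\in E(H)$, or $v=v'$ and $uu'\in E(G)$. *)

(* Defs.v *)
From mathcomp Require Import all_boot.

Set Implicit Arguments.
Unset Strict Implicit.
Unset Printing Implicit Defensive.

Record sgraph := SGraph {
  vertex :> finType;
  edge : rel vertex;
  edge_sym : symmetric edge;
  edge_irrefl : irreflexive edge }.

Notation "u -- v" := (edge u v) (at level 30).

Section Invariants.
Variable G : sgraph.
Implicit Types (u v : G) (E : {set {set G}}).

(* A walk with [k] edges from [u] to [v]; [p] lists the vertices after [u]. *)
Definition has_walk k u v :=
  [exists p : k.-tuple G, path (@edge G) u p && (last u p == v)].

(* A shortest walk has fewer than [#|G|] edges; the value [#|G|] stands for
   infinity when [u] and [v] are not connected. *)
Definition dist u v : nat := \big[minn/#|G|]_(k < #|G| | has_walk k u v) k.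

Definition is_cycle (c : seq G) :=
  [&& 2 < size c, uniq c & cycle (@edge G) c].

Definition has_cycle k := [exists c : k.-tuple G, is_cycle c].

(* A cycle has at most [#|G|] vertices; the value [#|G|.+1] stands for infinity
   when [G] has no cycle. *)
Definition girth : nat :=
  \big[minn/#|G|.+1]_(k < #|G|.+1 | has_cycle k) k.

Definition connected :=
  (0 < #|G|) && [forall u, forall v, connect (@edge G) u v].

Definition acyclic := [forall k : 'I_#|G|.+1, ~~ has_cycle k].

Definition is_tree := connected && acyclic.

Definition edge_set : {set {set G}} :=
  [set [set uv.1; uv.2] | uv : G * G & uv.1 -- uv.2].

Definition spanning_rel E : rel G :=
  [rel u v | (u != v) && ([set u; v] \in E)].

Lemma spanning_sym E : symmetric (spanning_rel E).
Proof. by move=> u v; rewrite /spanning_rel /= eq_sym setUC. Qed.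

Lemma spanning_irrefl E : irreflexive (spanning_rel E).
Proof. by move=> u; rewrite /spanning_rel /= eqxx. Qed.

(* The graph with all the vertices of [G] and edge set [E]. *)
Definition spanning_graph E : sgraph :=
  SGraph (spanning_sym E) (spanning_irrefl E).

End Invariants.

(* Spanning trees of [G] are represented by their edge sets. *)
Definition spanning_tree (G : sgraph) (T : {set {set G}}) :=
  (T \subset edge_set G) && is_tree (spanning_graph T).

Definition stretch (G : sgraph) (T : {set {set G}}) : nat :=
  \max_(uv : G * G | uv.1 -- uv.2) @dist (spanning_graph T) uv.1 uv.2.

(* The stretch of a spanning tree is less than [#|G|], so the value [#|G|] is
   only reached when there is no spanning tree, i.e. [G] is not connected. *)
Definition tree_stretch (G : sgraph) : nat :=
  \big[minn/#|G|]_(T : {set {set G}} | spanning_tree T) stretch T.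

Section Families.
Variable n : nat.

Definition path_rel : rel 'I_n :=
  [rel i j : 'I_n | (i.+1 == j :> nat) || (j.+1 == i :> nat)].

Lemma path_sym : symmetric path_rel.
Proof. by move=> i j; rewrite /path_rel /= orbC. Qed.

Lemma path_irrefl : irreflexive path_rel.
Proof. by move=> i; rewrite /path_rel /= orbb gtn_eqF. Qed.

Definition path_graph := SGraph path_sym path_irrefl.

(* This is the cycle graph for [2 < n] only. *)
Definition cycle_rel : rel 'I_n :=
  [rel i j : 'I_n | (i != j) && ((i.+1 %% n == j) || (j.+1 %% n == i))].

Lemma cycle_sym : symmetric cycle_rel.
Proof. by move=> i j; rewrite /cycle_rel /= eq_sym orbC. Qed.

Lemma cycle_irrefl : irreflexive cycle_rel.
Proof. by move=> i; rewrite /cycle_rel /= eqxx. Qed.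

Definition cycle_graph := SGraph cycle_sym cycle_irrefl.

Definition complete_rel : rel 'I_n := [rel i j : 'I_n | i != j].

Lemma complete_sym : symmetric complete_rel.
Proof. by move=> i j; rewrite /complete_rel /= eq_sym. Qed.

Lemma complete_irrefl : irreflexive complete_rel.
Proof. by move=> i; rewrite /complete_rel /= eqxx. Qed.

Definition complete_graph := SGraph complete_sym complete_irrefl.

Definition edgeless_rel : rel 'I_n := [rel i j : 'I_n | false].

Lemma edgeless_sym : symmetric edgeless_rel.
Proof. by []. Qed.

Lemma edgeless_irrefl : irreflexive edgeless_rel.
Proof. by []. Qed.

Definition edgeless_graph := SGraph edgeless_sym edgeless_irrefl.

End Families.

Section Operations.
Variables G H : sgraph.

Definition join_rel : rel (G + H)%type := fun x y =>
  match x, y with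
  | inl u, inl v => u -- v
  | inr u, inr v => u -- v
  | _, _ => true
  end.

Lemma join_sym : symmetric join_rel.
Proof. by move=> [u|u] [v|v] //=; rewrite edge_sym. Qed.

Lemma join_irrefl : irreflexive join_rel.
Proof. by move=> [u|u]; rewrite /= edge_irrefl. Qed.

Definition join_graph := SGraph join_sym join_irrefl.

Definition cartesian_rel : rel (G * H)%type := fun x y =>
  ((x.1 == y.1) && (x.2 -- y.2)) || ((x.2 == y.2) && (x.1 -- y.1)).

Lemma cartesian_sym : symmetric cartesian_rel.
Proof.
move=> [u v] [u' v']; rewrite /cartesian_rel /=.
by rewrite (eq_sym u) (eq_sym v) (edge_sym u) (edge_sym v).
Qed.

Lemma cartesian_irrefl : irreflexive cartesian_rel.
Proof. by move=> [u v]; rewrite /cartesian_rel /= !edge_irrefl !andbF. Qed.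

Definition cartesian_graph := SGraph cartesian_sym cartesian_irrefl.

End Operations.

Definition wheel n := join_graph (cycle_graph (n - 1)) (complete_graph 1).

Definition diamond n := join_graph (complete_graph 2) (edgeless_graph (n - 2)).

Definition complete_bipartite m n :=
  join_graph (edgeless_graph m) (edgeless_graph n).

Definition grid m n := cartesian_graph (path_graph m) (path_graph n).

(* The vertices [(false, i)] form the outer pentagon, the vertices [(true, i)]
   the inner pentagram, and the spokes join [(false, i)] to [(true, i)]. *)
Definition petersen_rel : rel (bool * 'I_5)%type := fun x y =>
  match x, y with
  | (false, i), (false, j) => (i.+1 %% 5 == j) || (j.+1 %% 5 == i)
  | (true, i), (true, j) => (i.+2 %% 5 == j) || (j.+2 %% 5 == i)
  | (_, i), (_, j) => i == j
  end.

Lemma petersen_sym : symmetric petersen_rel.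
Proof. by move=> [[] i] [[] j]; rewrite /petersen_rel 1?orbC // eq_sym. Qed.

Lemma petersen_irrefl : irreflexive petersen_rel.
Proof. by move=> [[] [[|[|[|[|[|i]]]]] Hi]]. Qed.

Definition petersen := SGraph petersen_sym petersen_irrefl.

(* Main.v *)
Require Import Defs.
From mathcomp Require Import all_boot all_order.
From mathcomp Require Import zify.

Set Implicit Arguments.
Unset Strict Implicit.
Unset Printing Implicit Defensive.

Import Order.TTheory.

(** The tree-stretch of each graph is squeezed between two bounds.

    Lower bound: if [G] has a cycle, a spanning tree [T] misses some edge [uv]
    of [G], and the [T]-path from [u] to [v] closes up with [uv] into a cycle of
    [G].  Hence [d_T(u, v) + 1 >= girth G], so [tree_stretch G >= girth G - 1]
    whatever the graph ([girth_le_stretch]).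

    Upper bound: it suffices to exhibit one spanning tree of stretch at most
    [girth G - 1].  All the trees are given by a root [r] and a parent map [p]
    along edges of [G] that decreases some rank; such a map always defines a
    spanning tree, and two vertices with [iter j p u = iter k p v] are at
    distance at most [j + k] in it, since both climb to the same ancestor.
    [tree_stretch_of_parents] combines the two bounds: a cycle of length
    [g + 1], the absence of shorter cycles, and a common ancestor within [g]
    steps for the ends of every edge together give [tree_stretch G = g].

    The trees are: a star for complete graphs, wheels and diamonds; the path
    [0, 1, ..., n - 1] for the cycle; two adjacent stars for [K_{m,n}]; the
    comb whose spine is the middle row for the grid [P_3 x P_n]; a breadth-first
    tree of depth 2 for the Petersen graph.  As for short cycles, [K_{m,n}] and
    the grids are bipartite, hence without triangles; a cycle in [C_n] is closed
    under adjacency, hence goes through every vertex; in the Petersen graph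
    adjacent vertices have no common neighbour and other pairs of distinct
    vertices have at most one, which excludes lengths 3 and 4. *)

(** * Minima of natural numbers *)

(** On [nat], [minn] and the order of naturals are instances of the generic
    minimum and order up to conversion only, so that the generic lemmas on
    iterated minima are restated to match the goals. *)
Lemma bigminn_le (I : finType) (P : pred I) (F : I -> nat) m i :
  P i -> \big[minn/m]_(j | P j) F j <= F i.
Proof. by move=> Pi; exact: (@bigmin_le_cond _ nat). Qed.

Lemma bigminn_le_default (I : finType) (P : pred I) (F : I -> nat) m :
  \big[minn/m]_(j | P j) F j <= m.
Proof. exact: (@bigmin_le_id _ nat). Qed.

Lemma le_bigminn (I : finType) (P : pred I) (F : I -> nat) m k :
  k <= m -> (forall i, P i -> k <= F i) -> k <= \big[minn/m]_(j | P j) F j.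
Proof. by move=> le_m le_F; exact: (@le_bigmin _ nat). Qed.

(** * Cycles and girth *)

Section Cycles.
Variable G : sgraph.
Implicit Types (u v x y : G) (c : seq G).

Lemma has_cycleP k :
  reflect (exists2 c : seq G, is_cycle c & size c = k) (@has_cycle G k).
Proof.
apply: (iffP existsP) => [[c cyc_c]|[c cyc_c sz_c]].
  by exists (val c); rewrite ?size_tuple.
by exists (tcast sz_c (in_tuple c)); rewrite val_tcast.
Qed.

Lemma has_cycle_le_card k : @has_cycle G k -> k <= #|G|.
Proof.
move=> /has_cycleP[c /and3P[_ c_uniq _] <-].
by rewrite -(card_uniqP c_uniq) max_card.
Qed.

Lemma girth_le k : @has_cycle G k -> girth G <= k.
Proof.
move=> Gk; have lt_k : k < #|G|.+1 by rewrite ltnS has_cycle_le_card.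
by rewrite -[leqRHS]/(val (Ordinal lt_k)); apply: bigminn_le.
Qed.

Lemma le_girth k0 k :
  @has_cycle G k0 -> (forall j, @has_cycle G j -> k <= j) -> k <= girth G.
Proof.
move=> Gk0 le_k; apply: le_bigminn => [|i Gi]; last exact: le_k.
exact: leq_trans (le_k _ Gk0) (leqW (has_cycle_le_card Gk0)).
Qed.

(** This local information is enough to show both that the tree of a parent map
    has no cycle and that a cycle of [C_n] goes all the way round. *)
Lemma cycle_two_neighbours c x : is_cycle c -> x \in c ->
  exists y z, [/\ y \in c, z \in c, y != z, x -- y & x -- z].
Proof.
move=> /and3P[sz_c uniq_c cyc_c] /rot_to[i c' def_c].
have mem_c : c =i x :: c' by move=> y; rewrite -def_c mem_rot.
move: sz_c uniq_c cyc_c.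
rewrite -(size_rot i) -(rot_uniq i) -(rot_cycle i) {}def_c.
case: c' mem_c => [|y c'] // mem_c.
case: (lastP c') mem_c => [|{}c' z] // mem_c _ /= /and3P[_ y_notin _].
rewrite rcons_path last_rcons => /andP[xy /andP[_ zx]].
exists y, z; rewrite xy (edge_sym x z) zx !mem_c !inE !mem_rcons !inE.
rewrite !eqxx !orbT.
by split=> //; apply: contraNneq y_notin => ->; rewrite mem_rcons mem_head.
Qed.

Lemma no_triangle_of_bicolouring (col : G -> bool) :
  (forall u v, u -- v -> col u != col v) ->
  forall k, @has_cycle G k -> 3 < k.
Proof.
move=> col_edge k /has_cycleP[c /and3P[sz_c _ cyc_c] <-].
case: c sz_c cyc_c => [|x [|y [|z [|t c]]]] //= _.
case/and4P=> /col_edge xy /col_edge yz /col_edge zx _.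
by case: (col x) (col y) (col z) xy yz zx => [] [] [].
Qed.

End Cycles.

(** * The girth bounds the stretch from below *)

Section SpanningTrees.
Variable G : sgraph.
Implicit Types (u v x y : G) (c : seq G).

Lemma spanning_tree_edge (T : {set {set G}}) u v :
  spanning_tree T -> @edge (spanning_graph T) u v -> u -- v.
Proof.
case/andP=> /subsetP T_sub _ /= /andP[uv /T_sub/imsetP[[x y]]].
rewrite inE /= => xy /setP eq_uv.
have := eq_uv u; have := eq_uv v; rewrite !inE !eqxx orbT /=.
case/esym/orP=> /eqP Ev /esym/orP[] /eqP Eu.
- by rewrite Eu Ev eqxx in uv.
- by rewrite Eu Ev edge_sym.
- by rewrite Eu Ev.
- by rewrite Eu Ev eqxx in uv.
Qed.

(** A tree containing all the edges of [G] would contain its cycles. *)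
Lemma missing_edge (T : {set {set G}}) k :
  @has_cycle G k -> spanning_tree T ->
  exists u v, u -- v /\ ~~ @edge (spanning_graph T) u v.
Proof.
move=> Gk /andP[_ /andP[_ /forallP T_acyclic]].
suff /existsP[u /exists_inP[v uv Tuv]] :
    [exists u : G, exists (v : G | u -- v), ~~ @edge (spanning_graph T) u v].
  by exists u, v.
apply: contraT => /existsPn sub_T.
have lt_k : k < #|spanning_graph T|.+1 by exact: has_cycle_le_card Gk.
case/negP: (T_acyclic (Ordinal lt_k)); apply/has_cycleP.
case/has_cycleP: Gk => c /and3P[sz_c uniq_c cyc_c] sz_ck; exists c => //.
apply/and3P; split=> //.
apply: (sub_cycle (e := @edge G)) cyc_c => u v uv.
by apply: contraT => Tuv; case/exists_inP: (sub_T u); exists v.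
Qed.

(** The missing edge closes the tree path between its ends into a cycle.  If the
    ends were not connected in [T] the distance would take its default value
    [#|G|], which also is at least [girth G - 1] since [G] has a cycle. *)
Lemma girth_le_dist (T : {set {set G}}) k u v :
  @has_cycle G k -> spanning_tree T ->
  u -- v -> ~~ @edge (spanning_graph T) u v ->
  girth G <= (@dist (spanning_graph T) u v).+1.
Proof.
move=> Gk T_tree uv Tuv; rewrite -add1n -leq_subLR; apply: le_bigminn => [|i].
  rewrite leq_subLR; apply: leqW.
  exact: leq_trans (girth_le Gk) (has_cycle_le_card Gk).
case/existsP=> p /andP[p_path /eqP p_last]; rewrite leq_subLR add1n.
(* A walk may repeat vertices; only its shortening [q] closes up to a cycle. *)
rewrite -(size_tuple p).
case/shortenP: p_path p_last => q q_path q_uniq q_sub q_last.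
apply: (@leq_trans (size q).+1); last first.
  by rewrite ltnS; apply: uniq_leq_size => //; case/andP: q_uniq.
apply: girth_le; apply/has_cycleP; exists (u :: q) => //.
apply/and3P; split=> //.
  case: q q_path q_last {q_sub q_uniq} => [|x [|y q]] //=.
    by move=> _ Euv; rewrite Euv edge_irrefl in uv.
  by move=> /andP[Tux _] Exv; case/negP: Tuv; rewrite -Exv.
rewrite /= rcons_path q_last edge_sym uv andbT.
by apply: (sub_path (e := @edge (spanning_graph T))) q_path => x y;
  apply: spanning_tree_edge.
Qed.

Lemma girth_le_stretch (T : {set {set G}}) k :
  @has_cycle G k -> spanning_tree T -> girth G <= (stretch T).+1.
Proof.
move=> Gk T_tree; have [u [v [uv Tuv]]] := missing_edge Gk T_tree.
apply: leq_trans (girth_le_dist Gk T_tree uv Tuv) _; rewrite ltnS.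
exact: (@leq_bigmax_cond _ _
  (fun e : G * G => @dist (spanning_graph T) e.1 e.2) (u, v)).
Qed.

(** * Spanning trees given by a parent map *)

Section ParentTree.
Variables (r : G) (p : G -> G) (h : G -> nat).
Hypothesis p_root : p r = r.
Hypothesis p_edge : forall v, v != r -> v -- p v.
Hypothesis p_rank : forall v, v != r -> h (p v) < h v.

Definition parent_tree : {set {set G}} := [set [set v; p v] | v in [set~ r]].

Local Notation T := (spanning_graph parent_tree).

Lemma parent_tree_edge u v :
  @edge T u v -> (v = p u /\ u != r) \/ (u = p v /\ v != r).
Proof.
move=> /= /andP[uv /imsetP[w]]; rewrite !inE => wr /setP eq_w.
have := eq_w u; have := eq_w v; rewrite !inE !eqxx orbT /=.
case/esym/orP=> /eqP Ev /esym/orP[] /eqP Eu.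
- by rewrite Eu Ev eqxx in uv.
- by right; rewrite Eu Ev.
- by left; rewrite Eu Ev.
- by rewrite Eu Ev eqxx in uv.
Qed.

Lemma edge_parent_tree v : v != r -> @edge T v (p v).
Proof.
move=> vr /=; apply/andP; split.
  by apply: contraTneq (p_rank vr) => <-; rewrite ltnn.
by apply/imsetP; exists v; rewrite // !inE.
Qed.

Lemma iter_parent_root v : exists k, iter k p v = r.
Proof.
have [n] := ubnP (h v); elim: n v => // n IHn v; rewrite ltnS => le_vn.
have [->|vr] := eqVneq v r; first by exists 0.
have [k <-] := IHn _ (leq_trans (p_rank vr) le_vn).
by exists k.+1; rewrite iterSr.
Qed.

Lemma connect_iter_parent k v : connect (@edge T) v (iter k p v).
Proof.
elim: k => [|k IHk] //=; apply: connect_trans IHk _.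
have [->|kr] := eqVneq (iter k p v) r; first by rewrite p_root.
exact/connect1/edge_parent_tree.
Qed.

Lemma parent_tree_connected : connected T.
Proof.
apply/andP; split; first by apply/card_gt0P; exists r.
have to_root v : connect (@edge T) v r.
  by have [k <-] := iter_parent_root v; apply: connect_iter_parent.
apply/forallP=> u; apply/forallP=> v; apply: connect_trans (to_root u) _.
by rewrite sym_connect_sym //; apply: edge_sym.
Qed.

(** On a cycle, a vertex of largest rank cannot be the parent of its neighbours,
    so both its neighbours would be its own parent, yet they are distinct. *)
Lemma parent_tree_acyclic : acyclic T.
Proof.
apply/forallP=> k; apply/negP=> /has_cycleP[c c_cyc _].
have [x0 cx0] : exists x, x \in c.
  by case: c c_cyc => [//|x c _]; exists x; apply: mem_head.
case: (@arg_maxnP G x0 (fun x => x \in c) h cx0) => x cx x_max.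
have [y [z [cy cz yz xy xz]]] := cycle_two_neighbours c_cyc cx.
have to_parent w : w \in c -> @edge T x w -> w = p x.
  move=> cw /parent_tree_edge[[]//|[Ex wr]].
  have : h w <= h x by apply: x_max.
  by rewrite leqNgt Ex p_rank.
by rewrite (to_parent y) // (to_parent z) // eqxx in yz.
Qed.

Lemma parent_tree_spanning : spanning_tree parent_tree.
Proof.
rewrite /spanning_tree /is_tree parent_tree_connected parent_tree_acyclic.
rewrite !andbT.
apply/subsetP=> _ /imsetP[v vr ->]; rewrite !inE in vr.
by apply/imsetP; exists (v, p v); rewrite // inE /= p_edge.
Qed.

(** The walk may have fewer than [k] edges, because [p] stays at the root once
    it gets there. *)
Lemma parent_walk k v :
  exists q, [/\ path (@edge T) v q, last v q = iter k p v & size q <= k].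
Proof.
elim: k => [|k [q [q_path q_last q_size]]] /=; first by exists [::].
have [Ek|kr] := eqVneq (iter k p v) r.
  by exists q; rewrite Ek p_root -Ek q_last leqW.
exists (rcons q (p (iter k p v))).
rewrite rcons_path q_path q_last last_rcons size_rcons ltnS q_size.
by split=> //; apply: edge_parent_tree.
Qed.

(** Climb from [u] to the common ancestor, then descend to [v]. *)
Lemma dist_parent_tree u v j k :
  iter j p u = iter k p v -> @dist T u v <= j + k.
Proof.
move=> meet; have [q [q_path q_last q_size]] := parent_walk j u.
have [s [s_path s_last s_size]] := parent_walk k v.
pose w := q ++ rev (belast v s).
have w_path : path (@edge T) u w.
  rewrite cat_path q_path q_last meet -s_last rev_path /=.
  by apply: sub_path s_path => x y; rewrite edge_sym.
have w_last : last u w = v.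
  rewrite last_cat q_last meet -s_last.
  by case: (s) => //= x s'; rewrite rev_cons last_rcons.
have w_size : size w <= j + k by rewrite size_cat size_rev size_belast leq_add.
apply: leq_trans w_size; have [lt_w|] := ltnP (size w) #|T|; last first.
  by apply: leq_trans; apply: bigminn_le_default.
rewrite -[leqRHS]/(val (Ordinal lt_w)); apply: bigminn_le.
by apply/existsP; exists (in_tuple w); rewrite w_path w_last /=.
Qed.

(** The common principle behind all seven families: a tree whose stretch is one
    less than the length of a shortest cycle is optimal. *)
Lemma tree_stretch_of_parents g :
  @has_cycle G g.+1 -> (forall k, @has_cycle G k -> g < k) ->
  (forall u v, u -- v -> exists j k, iter j p u = iter k p v /\ j + k <= g) ->
  tree_stretch G = girth G - 1 /\ tree_stretch G = g.
Proof.
move=> Gg ge_g meet.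
have girth_g : girth G = g.+1.
  by apply/eqP; rewrite eqn_leq girth_le // (le_girth Gg).
suff -> : tree_stretch G = g by rewrite girth_g subn1.
apply/eqP; rewrite eqn_leq; apply/andP; split.
  apply: leq_trans (bigminn_le _ _ parent_tree_spanning) _.
  apply/bigmax_leqP=> -[u v] /= /meet[j [k [jk]]]; apply: leq_trans.
  exact: dist_parent_tree.
apply: le_bigminn => [|S S_tree].
  exact: leq_trans (leqnSn g) (has_cycle_le_card Gg).
by rewrite -ltnS -girth_g; apply: girth_le_stretch Gg S_tree.
Qed.

End ParentTree.

(** In the star at [r] all other vertices have the same parent, so distances are
    at most 2; [r] and the edge [xy] form a triangle. *)
Lemma tree_stretch_of_dominating (r x y : G) :
  (forall v, v != r -> v -- r) -> x != r -> y != r -> x -- y ->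
  tree_stretch G = girth G - 1 /\ tree_stretch G = 2.
Proof.
move=> r_dom xr yr xy.
apply: (@tree_stretch_of_parents r (fun=> r) (fun v => v != r)) => //.
- by move=> v ->; rewrite eqxx.
- apply/has_cycleP; exists [:: r; x; y] => //.
  rewrite /is_cycle /= !inE negb_or (eq_sym r) (eq_sym r) xr yr xy.
  rewrite edge_sym !r_dom //= !andbT.
  by apply: contraTneq xy => ->; rewrite edge_irrefl.
- by move=> k /has_cycleP[c /and3P[? _ _] <-].
- by move=> u v _; exists 1, 1.
Qed.

End SpanningTrees.

(** * Complete graphs, wheels and diamonds *)

Lemma tree_stretch_complete n : 3 <= n ->
  tree_stretch (complete_graph n) = girth (complete_graph n) - 1 /\
  tree_stretch (complete_graph n) = 2.
Proof.
case: n => [|[|[|n]]] // _.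
apply: (@tree_stretch_of_dominating (complete_graph n.+3)
  ord0 (@Ordinal n.+3 1 isT) (@Ordinal n.+3 2 isT)) => //.
Qed.

Lemma tree_stretch_wheel n : 4 <= n ->
  tree_stretch (wheel n) = girth (wheel n) - 1 /\ tree_stretch (wheel n) = 2.
Proof.
case: n => [|[|[|[|n]]]] // _.
apply: (@tree_stretch_of_dominating (wheel n.+4)
  (inr ord0) (inl (@Ordinal n.+3 0 isT))
  (inl (@Ordinal n.+3 1 isT))) => //.
by move=> [v|v] //; rewrite ord1.
Qed.

Lemma tree_stretch_diamond n : 4 <= n ->
  tree_stretch (diamond n) = girth (diamond n) - 1 /\
  tree_stretch (diamond n) = 2.
Proof.
case: n => [|[|[|[|n]]]] // _.
apply: (@tree_stretch_of_dominating (diamond n.+4)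
  (inl ord0) (inl ord_max) (inr (@ord0 n.+1))) => //.
by move=> [v|v].
Qed.

(** * Complete bipartite graphs *)

(** The tree is made of the stars at two adjacent vertices [r] and [s]: a vertex
    on the side of [r] reaches [r] through [s] in two steps, and a vertex on the
    other side does so in one. *)
Lemma tree_stretch_complete_bipartite m n : 2 <= m -> 2 <= n ->
  tree_stretch (complete_bipartite m n)
    = girth (complete_bipartite m n) - 1 /\
  tree_stretch (complete_bipartite m n) = 3.
Proof.
case: m n => [|[|m]] [|[|n]] // _ _.
pose G := complete_bipartite m.+2 n.+2.
pose r : G := inl ord0; pose s : G := inr ord0.
pose p (v : G) : G := if v is inl i then if i == ord0 then r else s else r.
pose h (v : G) := if v == r then 0 else if v is inl _ then 2 else 1.
apply: (@tree_stretch_of_parents G r p h) => //.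
- move=> [i|j] // i0.
  by rewrite /p (inj_eq inl_inj) in i0 *; rewrite (negPf i0).
- move=> [i|j] // i0; rewrite /h (negPf i0) /p //.
  by rewrite (inj_eq inl_inj) in i0; rewrite (negPf i0).
- apply/has_cycleP; exists [:: r; s; inl ord_max; inr ord_max] => //.
- apply: (@no_triangle_of_bicolouring G
    (fun v => if v is inl _ then true else false)).
  by move=> [i|j] [i'|j'].
(* The root also gets back to itself in two steps, as [p r = r]. *)
have reach_r v : iter (if v is inl _ then 2 else 1) p v = r.
  by case: v => [i|j] //=; case: eqP.
move=> [i|i] [j|j] // _.
  by exists 2, 1; split=> //; rewrite (reach_r (inl i)) (reach_r (inr j)).
by exists 1, 2; split=> //; rewrite (reach_r (inl j)) (reach_r (inr i)).
Qed.

(** * Cycle graphs *)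

Lemma iter_ordS n (i : 'I_n) k : val (iter k (@ordS n) i) = (i + k) %% n.
Proof.
elim: k => [|k IHk] /=; first by rewrite addn0 modn_small.
by rewrite IHk -addn1 modnDml addn1 addnS.
Qed.

(** The vertices of [C_n] are all reached from any one of them by successors. *)
Lemma ordS_closed_full n (c : seq 'I_n) i :
  i \in c -> (forall j, j \in c -> ordS j \in c) -> n <= size c.
Proof.
move=> ci closed; rewrite -[leqLHS]card_ord cardE.
apply: uniq_leq_size; first exact: enum_uniq.
move=> j _; rewrite (_ : j = iter (n - i + j) (@ordS n) i); last first.
  apply: val_inj; rewrite iter_ordS addnA subnKC; last exact: ltnW.
  by rewrite modnDl modn_small.
by elim: (_ + _) => //= k; apply: closed.
Qed.

(** Both neighbours of a vertex [i] of the cycle are among its successor and its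
    predecessor and they are distinct, so one of them is the successor: the
    vertices of the cycle are closed under successor. *)
Lemma cycle_graph_le_cycle n k : @has_cycle (cycle_graph n) k -> n <= k.
Proof.
case/has_cycleP=> c c_cyc <-.
have [i ci] : exists i, i \in c.
  by case: c c_cyc => [//|i c _]; exists i; apply: mem_head.
apply: ordS_closed_full ci _ => {}i.
case/(cycle_two_neighbours c_cyc)=> x [y [cx cy xy]].
case/andP=> _ /orP[/eqP ix|/eqP xi] /andP[_ /orP[/eqP iy|/eqP yi]].
- by rewrite (_ : ordS i = x) //; apply: val_inj.
- by rewrite (_ : ordS i = x) //; apply: val_inj.
- by rewrite (_ : ordS i = y) //; apply: val_inj.
- case/eqP: xy; apply: ordS_inj; apply: val_inj.
  by rewrite /= xi yi.
Qed.

(** The cycle is the orbit of [0] under the successor map; that it has [n]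
    elements follows from its being closed under successor. *)
Lemma cycle_graph_has_cycle n : 3 <= n -> @has_cycle (cycle_graph n) n.
Proof.
case: n => [|n] // n2; pose c := orbit (@ordS n.+1) ord0.
have c_size : size c = n.+1.
  apply/eqP; rewrite eqn_leq; apply/andP; split.
    by rewrite -[leqRHS]card_ord -(card_uniqP (orbit_uniq _ _)) max_card.
  apply: (@ordS_closed_full _ c ord0); first exact: in_orbit.
  move=> j; rewrite -!fconnect_orbit => /connect_trans; apply.
  exact: fconnect1.
apply/has_cycleP; exists c => //; apply/and3P; split; rewrite ?c_size //.
  exact: orbit_uniq.
apply: (sub_cycle (e := frel (@ordS n.+1))) (cycle_orbit (@ordS_inj _) _).
move=> i j /eqP <-; apply/andP; split; last by rewrite /= eqxx.
rewrite -val_eqE /=; have [lt_i|le_n] := ltnP i n.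
  by rewrite modn_small // ltn_eqF.
by have -> : i = n :> nat; [have := ltn_ord i | rewrite modnn]; lia.
Qed.

(** The tree is the path [0, ..., n - 1] rooted at [0]; the only missing edge
    joins its ends. *)
Lemma tree_stretch_cycle n : 3 <= n ->
  tree_stretch (cycle_graph n) = girth (cycle_graph n) - 1 /\
  tree_stretch (cycle_graph n) = n - 1.
Proof.
case: n => [|n] // n2; have -> : n.+1 - 1 = n by rewrite subn1.
pose p (i : 'I_n.+1) : 'I_n.+1 := inord i.-1.
have val_p i : val (p i) = i.-1.
  by rewrite /= inordK // (leq_ltn_trans (leq_pred i)).
have pos_nroot (i : 'I_n.+1) : i != ord0 -> 0 < i by rewrite lt0n.
have p_lt (i : 'I_n.+1) : 0 < i -> p i < i by move=> i0; rewrite val_p prednK.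
apply: (@tree_stretch_of_parents (cycle_graph n.+1) ord0 p
  (@nat_of_ord _)) => //.
- exact/val_inj/val_p.
- move=> i /pos_nroot i0; apply/andP; split.
    by apply: contraTneq (p_lt i i0) => <-; rewrite ltnn.
  by apply/orP; right; rewrite val_p prednK // modn_small.
- by move=> i /pos_nroot; apply: p_lt.
- exact: cycle_graph_has_cycle.
- exact: cycle_graph_le_cycle.
have iter_p k i : val (iter k p i) = i - k.
  by elim: k => [|k IHk] /=; rewrite ?subn0 // val_p IHk subnS.
(* Either [i] is the parent of [j], or [i = n] is the last vertex and [j = 0]
   is the root, which [i] reaches in [n] steps. *)
have succ (i j : cycle_graph n.+1) :
    i.+1 %% n.+1 == j ->
    exists k l, iter k p i = iter l p j /\ k + l <= n.
  move=> /eqP ij; have [lt_i|] := ltnP i n.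
    exists 0, 1; split; last by lia.
    by apply: val_inj; rewrite !iter_p /= -ij modn_small // subSS subn0.
  move=> le_n; exists n, 0; split; last by rewrite addn0.
  have Ei : i = n :> nat by apply/eqP; rewrite eqn_leq le_n -ltnS ltn_ord.
  by apply: val_inj; rewrite !iter_p /= -ij Ei modnn subnn.
move=> i j /andP[_ /orP[/succ // | /succ[k [l [ji le_kl]]]]].
by exists l, k; rewrite ji addnC.
Qed.

(** * Grids *)

Lemma grid_bicolouring m n (u v : grid m n) :
  u -- v -> odd (u.1 + u.2) != odd (v.1 + v.2).
Proof.
case: u v => [i j] [i' j'] /orP[] /andP[/eqP /= ->].
  by rewrite !oddD => /orP[] /eqP <- /=; do 2![case: (odd _)].
by rewrite !oddD => /orP[] /eqP <- /=; do 2![case: (odd _)].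
Qed.

(** The tree is a comb: the middle row is a path rooted at its end, and every
    other vertex is attached to the middle vertex of its column. *)
Lemma tree_stretch_grid n : 2 <= n ->
  tree_stretch (grid 3 n) = girth (grid 3 n) - 1 /\
  tree_stretch (grid 3 n) = 3.
Proof.
case: n => [|[|n]] // _.
pose G := grid 3 n.+2.
pose mid : 'I_3 := @Ordinal 3 1 isT.
pose pred (j : 'I_n.+2) : 'I_n.+2 := inord j.-1.
have val_pred j : pred j = j.-1 :> nat.
  by rewrite /= inordK // (leq_ltn_trans (leq_pred j)).
pose r : G := (mid, ord0).
pose p (v : G) : G := (mid, if v.1 == mid then pred v.2 else v.2).
pose h (v : G) : nat := v.2 + (v.1 != mid).
have not_root (j : 'I_n.+2) : (mid, j) != r -> 0 < j.
  by rewrite xpair_eqE eqxx lt0n.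
have mid_adj (i : 'I_3) : (i == mid) = ~~ path_rel i mid.
  by case: i => [[|[|[|i]]] lt_i].
apply: (@tree_stretch_of_parents G r p h) => //.
- by rewrite /p eqxx; congr (_, _); apply/val_inj/val_pred.
- move=> [i j]; rewrite /p /= /cartesian_rel /=.
  have [->|i_mid] := eqVneq i mid.
    move/not_root=> j0; apply/orP; left; apply/orP; right.
    by rewrite -[X in _ == X](prednK j0) eqSS; apply/eqP/val_pred.
  rewrite mid_adj negbK in i_mid.
  by move=> _; apply/orP; right; apply/andP.
- move=> [i j]; rewrite /h /p /= addn0.
  have [->|_ _] := eqVneq i mid.
    by move/not_root=> j0; rewrite addn0 val_pred prednK.
  by rewrite addn1.
- apply/has_cycleP.
  pose j1 := @Ordinal n.+2 1 isT.
  by exists [:: r; (mid, j1); (ord0, j1); (ord0, ord0)].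
- exact: no_triangle_of_bicolouring (@grid_bicolouring _ _).
(* Two neighbours outside the middle row are joined through it: one step to the
   middle on one side; to the middle and then along it on the other. *)
have along (i : 'I_3) (j j' : 'I_n.+2) : j.+1 = j' ->
    exists k l, iter k p (i, j) = iter l p (i, j') /\ k + l <= 3.
  move=> jj'; have p_up : p (mid, j') = (mid, j).
    by rewrite /p eqxx; congr (_, _); apply: val_inj; rewrite /= val_pred -jj'.
  have [->|i_mid] := eqVneq i mid; first by exists 0, 1.
  exists 1, 2; split=> //=.
  by rewrite [p (i, j')]/p /= (negPf i_mid) p_up /p /= (negPf i_mid).
have across (i i' : 'I_3) (j : 'I_n.+2) : i.+1 = i' ->
    exists k l, iter k p (i, j) = iter l p (i', j) /\ k + l <= 3.
  case: i i' => [[|[|[|i]]] lt_i] [[|[|[|i']]] lt_i'] //= _.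
    exists 1, 0; split=> //=; congr (_, _); exact: val_inj.
  exists 0, 1; split=> //=; congr (_, _); exact: val_inj.
have flip (u v : G) :
    (exists k l, iter k p v = iter l p u /\ k + l <= 3) ->
    exists k l, iter k p u = iter l p v /\ k + l <= 3.
  by case=> k [l [vu le_kl]]; exists l, k; rewrite vu addnC.
move=> [i j] [i' j'] /orP[] /andP[/eqP /= <-] /orP[] /eqP.
- exact: along.
- by move=> jj'; apply/flip/along.
- exact: across.
- by move=> ii'; apply/flip/across.
Qed.

(** * The Petersen graph *)

(** An explicit list, because the enumeration of a finite type does not
    compute; properties of all the vertices are then checked by evaluation. *)
Definition petersen_vertices : seq petersen :=
  [seq (b, i) | b <- [:: false; true],
    i <- [:: @Ordinal 5 0 isT; @Ordinal 5 1 isT; @Ordinal 5 2 isT;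
             @Ordinal 5 3 isT; @Ordinal 5 4 isT]].

Lemma all_petersenP (P : pred petersen) :
  all P petersen_vertices -> forall v, P v.
Proof.
move/allP=> allP v; apply: allP.
by case: v => [[] [[|[|[|[|[|i]]]]] lt_i]].
Qed.

Lemma petersen_no_triangle (x y z : petersen) : x -- y -> y -- z -> ~~ (z -- x).
Proof.
have : all (fun x => all (fun y => all (fun z : petersen =>
    x -- y ==> (y -- z ==> ~~ (z -- x)))
    petersen_vertices) petersen_vertices) petersen_vertices by vm_compute.
move/all_petersenP/(_ x)/all_petersenP/(_ y)/all_petersenP/(_ z).
by move=> /implyP H xy; apply/implyP/H.
Qed.

Lemma petersen_common_neighbour (x y z t : petersen) :
  x -- y -> y -- z -> z -- t -> t -- x -> (x == z) || (y == t).
Proof.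
have : all (fun x => all (fun y => all (fun z => all (fun t : petersen =>
    [&& x -- y, y -- z, z -- t & t -- x] ==> ((x == z) || (y == t)))
    petersen_vertices) petersen_vertices) petersen_vertices) petersen_vertices.
  by vm_compute.
move/all_petersenP/(_ x)/all_petersenP/(_ y).
move/all_petersenP/(_ z)/all_petersenP/(_ t)/implyP=> H xy yz zt tx.
by apply: H; rewrite xy yz zt.
Qed.

Lemma petersen_cycle_size k : @has_cycle petersen k -> 4 < k.
Proof.
case/has_cycleP=> c /and3P[sz_c uniq_c cyc_c] <-.
case: c sz_c uniq_c cyc_c => [|x [|y [|z [|t [|u c]]]]] //= _.
  move=> _ /and4P[xy yz zx _].
  by case/negP: (petersen_no_triangle xy yz).
rewrite !inE !negb_or -!andbA => /and4P[_ xz _ /and4P[_ yt _ _]].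
move=> /and5P[xy yz zt tx _].
by have := petersen_common_neighbour xy yz zt tx; rewrite (negPf xz) (negPf yt).
Qed.

(** The Petersen graph has diameter 2, so a breadth-first tree has depth 2 and
    any two vertices have the root as a common ancestor, two steps up. *)
Lemma tree_stretch_petersen :
  tree_stretch petersen = girth petersen - 1 /\ tree_stretch petersen = 4.
Proof.
pose r : petersen := (false, ord0).
pose p (v : petersen) : petersen :=
  match v with
  | (true, i) => if (i == 2 :> nat) || (i == 3 :> nat) then (true, ord0)
                 else (false, i)
  | (false, i) => if i == 2 :> nat then (false, @Ordinal 5 1 isT)
                  else if i == 3 :> nat then (false, @Ordinal 5 4 isT) else r
  end.
(* The rank is the depth in the tree. *)
pose h (v : petersen) := if v == r then 0 else if p v == r then 1 else 2.
have pp v : p (p v) = r.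
  by apply/eqP; move: v; apply/all_petersenP.
apply: (@tree_stretch_of_parents petersen r p h) => //.
- by move=> v; apply/implyP; move: v; apply/all_petersenP.
- by move=> v; apply/implyP; move: v; apply/all_petersenP.
- apply/has_cycleP.
  by exists [seq (false, i) | i <- [:: @Ordinal 5 0 isT; @Ordinal 5 1 isT;
    @Ordinal 5 2 isT; @Ordinal 5 3 isT; @Ordinal 5 4 isT]].
- exact: petersen_cycle_size.
- by move=> u v _; exists 2, 2; rewrite /= !pp.
Qed.

Theorem proposition2p3 :
  (forall n : nat, 3 <= n ->
     tree_stretch (complete_graph n) = girth (complete_graph n) - 1 /\
     tree_stretch (complete_graph n) = 2) /\
  (forall n : nat, 3 <= n ->
     tree_stretch (cycle_graph n) = girth (cycle_graph n) - 1 /\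
     tree_stretch (cycle_graph n) = n - 1) /\
  (forall n : nat, 4 <= n ->
     tree_stretch (wheel n) = girth (wheel n) - 1 /\
     tree_stretch (wheel n) = 2) /\
  (forall n : nat, 4 <= n ->
     tree_stretch (diamond n) = girth (diamond n) - 1 /\
     tree_stretch (diamond n) = 2) /\
  (forall m n : nat, 2 <= m -> 2 <= n ->
     tree_stretch (complete_bipartite m n)
       = girth (complete_bipartite m n) - 1 /\
     tree_stretch (complete_bipartite m n) = 3) /\
  (forall n : nat, 2 <= n ->
     tree_stretch (grid 3 n) = girth (grid 3 n) - 1 /\
     tree_stretch (grid 3 n) = 3) /\
  (tree_stretch petersen = girth petersen - 1 /\
   tree_stretch petersen = 4).
Proof.
split; first exact: tree_stretch_complete.
split; first exact: tree_stretch_cycle.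
split; first exact: tree_stretch_wheel.
split; first exact: tree_stretch_diamond.
split; first exact: tree_stretch_complete_bipartite.
split; first exact: tree_stretch_grid.
exact: tree_stretch_petersen.
Qed.
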